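(* There exists an absolute constant $C>0$ such that for every positive integer $t$ and every finite graph $G$ of treewidth at most $t$, the hypergraph of balls in $G$ has a proper sample compression scheme of size at most $C\,t\log(t+1)$ (i.e. of size $\mathcal{O}(t\log t)$).
   Context: A hypergraph $H$ is a pair $(V(H),E(H))$ with $V(H)$ a finite set and $E(H)$ a set of subsets of $V(H)$ (hyperedges). A sample of $H$ is a pair $(X^+,X^-)$ of subsets of $V(H)$ such that some $e\in E(H)$ satisfies $X^+\subseteq e$ and $X^-\cap e=\emptyset$; $\mathcal{S}(H)$ is the set of samples. A set $S\subseteq V(H)$ realizes $(X^+,X^-)$ if $X^+\subseteq S$ and $S\cap X^-=\emptyset$. $(Y^+,Y^-)$ is a subsample of $(X^+,X^-)$ if $Y^+\subseteq X^+$, $Y^-\subseteq X^-$; the size of a sample is $|X^+\cup X^-|$. A sample compression scheme of $H$ is a pair $(\kappa,\rho)$ with $\kappa:\mathcal{S}(H)\to\mathcal{S}(H)\times\{0,1\}^*$ and $\rho:\mathcal{S}(H)\times\{0,1\}^*\to 2^{V(H)}$ such that for every sample $(X^+,X^-)$, writing $\kappa(X^+,X^-)=(\kappa_1,\kappa_2)$, $\kappa_1$ is a subsample of $(X^+,X^-)$ and $\rho(\kappa(X^+,X^-))$ realizes $(X^+,X^-)$. Its size is $k_1+k_2$, where $k_1$ is the maximum size of $\kappa_1(X^+,X^-)$ and $k_2$ the maximum length of the bitstring $\kappa_2(X^+,X^-)$ over all samples. It is proper if all values of $\rho$ lie in $E(H)$. For a graph $G$, $\mathrm{dist}_G(u,v)$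 is the number of edges of a shortest $u$-$v$ path ($\infty$ if none), and for $c\in V(G)$ and an integer $r$, $B_G(c,r)=\{v\in V(G):\mathrm{dist}_G(c,v)\le r\}$. The hypergraph of balls in $G$ has vertex set $V(G)$ and hyperedges all $B_G(c,r)$ for $c\in V(G)$ and integers $r$. Treewidth is the usual notion: minimum over tree decompositions $(T,(W_x)_{x\in V(T)})$ of $\max|W_x|-1$. *)

(* Defs.v *)
From mathcomp Require Import all_boot.
From mathcomp Require Import all_order ssralg ssrint.
From Stdlib Require Import Reals.

Set Implicit Arguments.
Unset Strict Implicit.
Unset Printing Implicit Defensive.

(* A hypergraph on the finite vertex type V is given by a predicate E on
   subsets of V (the hyperedges). A sample is a pair (X+, X-). *)

Definition sample_t (V : finType) := ({set V} * {set V})%type.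

Definition realizes (V : finType) (S : {set V}) (X : sample_t V) : bool :=
  (X.1 \subset S) && [disjoint S & X.2].

Definition is_sample (V : finType) (E : {set V} -> Prop) (X : sample_t V) : Prop :=
  exists2 A, E A & realizes A X.

Definition subsample (V : finType) (Y X : sample_t V) : bool :=
  (Y.1 \subset X.1) && (Y.2 \subset X.2).

Definition sample_size (V : finType) (X : sample_t V) : nat := #|X.1 :|: X.2|.

Definition proper_compression_scheme (V : finType) (E : {set V} -> Prop)
    (kappa : sample_t V -> sample_t V * seq bool)
    (rho : sample_t V * seq bool -> {set V}) (k1 k2 : nat) : Prop :=
  (forall X, is_sample E X ->
     [/\ subsample (kappa X).1 X, realizes (rho (kappa X)) X,
         sample_size (kappa X).1 <= k1 & size (kappa X).2 <= k2]) /\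
  (forall Y b, is_sample E Y -> E (rho (Y, b))).

Definition has_proper_scheme_of_size_le (V : finType) (E : {set V} -> Prop)
    (s : nat) : Prop :=
  exists kappa rho k1 k2,
    (k1 + k2 <= s)%N /\ proper_compression_scheme E kappa rho k1 k2.

Definition simple_graph (T : finType) (e : rel T) : Prop :=
  symmetric e /\ irreflexive e.

(* B_G(c, r) = { v | dist_G(c, v) <= r }: dist_G(c,v) <= r iff there is a walk
   c = x0, x1, ..., xk = v with k <= r (k edges). For r < 0 the ball is empty. *)
Definition ball (T : finType) (e : rel T) (c : T) (r : int) : {set T} :=
  [set v | [exists k : 'I_#|T|.+1,
     ((Posz k <= r)%O && [exists p : k.-tuple T, path e c p && (last c p == v)])]].

Definition is_ball (T : finType) (e : rel T) (A : {set T}) : Prop :=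
  exists (c : T) (r : int), A = ball e c r.

Definition is_tree (I : finType) (f : rel I) : Prop :=
  [/\ symmetric f, irreflexive f, (0 < #|I|)%N,
      (forall x y, connect f x y) &
      (* no cycle: no simple closed walk of length >= 3 *)
      (forall (x : I) (p : seq I), path f x p -> uniq (x :: p) ->
         (2 <= size p)%N -> ~~ f (last x p) x)].

Definition tree_decomposition (T : finType) (e : rel T)
    (I : finType) (f : rel I) (W : I -> {set T}) : Prop :=
  [/\ is_tree f,
      (forall v : T, exists x, v \in W x),
      (forall u v : T, e u v -> exists x, (u \in W x) && (v \in W x)) &
      (forall (v : T) (x y : I), v \in W x -> v \in W y ->
         connect [rel a b | [&& f a b, v \in W a & v \in W b]] x y)].

Definition treewidth_le (T : finType) (e : rel T) (t : nat) : Prop :=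
  exists (I : finType) (f : rel I) (W : I -> {set T}),
    tree_decomposition e f W /\ (forall x, #|W x| <= t.+1)%N.

(* Main.v *)
(* Fix a tree decomposition (T, W) and a node n(v) with v in W_(n(v)) for every
   vertex v. Let B(c, r) realize the sample X.  Viewed from n(c), the nodes n(v),
   v in X, all lie behind one of two nodes z1, z2, each of which is the median
   of three nodes n(v); so six sample vertices determine z1 and z2, and every
   shortest path from c to X meets the union of the two bags.  For each w in
   these bags keep the farthest v in X+ with d(c,w) + d(w,v) <= r and the v in X-
   closest to w.  Any ball B(c', r') satisfying the resulting inequalities
   realizes X, provided that the component of T - {z1, z2} containing n(c') has no
   n(v), v in X.  Take the first such component in a fixed order: the last
   earlier component having a suitable (c', r') contains some n(v), v in X, and
   sending this v lets the decoder skip to the right component.  This uses O(t)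
   vertices, and O(log t) bits for each to tell its role. *)

From mathcomp Require Import all_boot.
From mathcomp Require Import ssrint zify.
From Stdlib Require Import Reals Lra.
From mathcomp Require Import ssrnat.
Require Import Defs.

Set Implicit Arguments.
Unset Strict Implicit.
Unset Printing Implicit Defensive.

(** * Separation by a node, and medians in trees *)

Section Separation.

Variables (I : finType) (f : rel I).
Hypothesis fsym : symmetric f.

Definition avoid (z : I) : rel I := fun a b => [&& f a b, a != z & b != z].

(** Every walk from [a] to [b] meets [z], endpoints included. The first disjunct settles
    [a = b = z], where [connect] holds by reflexivity. *)
Definition sep (z a b : I) : bool := (a == z) || ~~ connect (avoid z) a b.

Lemma avoid_connect_sym z : connect_sym (avoid z).
Proof.
apply: sym_connect_sym => a b; rewrite /avoid fsym.
by case: (b == z); case: (a == z).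
Qed.

Lemma connect_avoid_cut z a : connect (avoid z) a z -> a = z.
Proof.
case/connectP => p pth lst; case/lastP: p pth lst => [_ ->//|p y].
rewrite rcons_path last_rcons => /andP[_ /and3P[_ _ yz]] zy.
by rewrite zy eqxx in yz.
Qed.

Lemma sep_sym z a b : sep z a b = sep z b a.
Proof.
rewrite /sep avoid_connect_sym.
have [->|az] := eqVneq a z; have [->|bz] := eqVneq b z => //=.
- by apply/esym/negP => /connect_avoid_cut /eqP; rewrite (negPf bz).
- by rewrite avoid_connect_sym; apply/negP => /connect_avoid_cut /eqP; rewrite (negPf az).
Qed.

Lemma sepxx z a : sep z a a = (a == z).
Proof. by rewrite /sep connect0 orbF. Qed.

Lemma nsep_trans z b a c : ~~ sep z a b -> ~~ sep z b c -> ~~ sep z a c.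
Proof.
rewrite /sep !negb_or !negbK => /andP[-> ab] /andP[_ bc] /=.
exact: connect_trans bc.
Qed.

Lemma sep_step z a b r : f a b -> a != z -> sep z a r -> sep z b r.
Proof.
rewrite /sep => ab az; rewrite (negPf az) /=.
have [//|bz /=] := eqVneq b z; apply: contra => br.
by apply: connect_trans br; apply: connect1; rewrite /avoid /= ab az bz.
Qed.

(** The given walk has to pass through [g], and its remainder from there serves. *)
Lemma connect_through z g x r :
  sep g x r -> connect (avoid z) x r -> connect (avoid z) g r.
Proof.
move=> sx /connectP[p pth lst]; move: sx; rewrite {}lst.
elim: p x pth => [|y p IHp] x /=.
  by move=> _; rewrite sepxx => /eqP ->.
case/andP=> /andP[xy /andP[xz yz]] pth sx.
have [<-|xg] := eqVneq x g.
  by apply/connectP; exists (y :: p) => //=; rewrite /avoid xy xz yz.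
by apply: IHp => //; apply: sep_step sx.
Qed.

Lemma sep_trans z g x r : sep g x r -> sep z g r -> sep z x r.
Proof.
move=> sx; rewrite {1 2}/sep; have [<-//|_ /= ngr] := eqVneq g z.
by apply/orP; right; apply: contra ngr; apply: connect_through.
Qed.

(** Take for [h] the node just before the first visit to [g]. The relation [f'] may forbid a further
    node, which [h] then avoids too. *)
Lemma exit_neighbor (f' : rel I) g y : subrel f' f -> connect f' y g -> y != g ->
  exists2 h, ~~ sep g y h & f' h g.
Proof.
move=> sub /connectP[p]; elim: p y => [|x p IHp] y /=; first by move=> _ ->; rewrite eqxx.
case/andP=> yx pth lst yg; have [xg|xg] := eqVneq x g.
  by exists y; rewrite ?sepxx // -xg.
have [h xh hg] := IHp _ pth lst xg; exists h => //; apply: nsep_trans xh.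
by rewrite /sep negb_or negbK yg connect1 // /avoid yg xg sub.
Qed.

Hypothesis fconn : forall x y, connect f x y.

(** Until its first visit to [z], a walk from [y] stays cut off from [w] by [z], so it cannot meet
    [w]. *)
Lemma sep_connect z w y : w != z -> sep z y w -> connect (avoid w) y z.
Proof.
move=> wz; case/connectP: (fconn y z) => p; elim: p y => [|x p IHp] y /=.
  by move=> _ ->.
case/andP=> yx pth lst syw; have [->//|yz] := eqVneq y z.
have sxw := sep_step yx yz syw.
have yw : y != w by apply: contraTneq syw => ->; rewrite sepxx.
have xw : x != w by apply: contraTneq sxw => ->; rewrite sepxx.
by apply: connect_trans (IHp x pth lst sxw); rewrite connect1 // /avoid yx yw xw.
Qed.

Definition median (z a b c : I) : bool := [&& sep z a b, sep z b c & sep z a c].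

(** Seen from [z], the node [z'] lies on the side of at most one of [a], [b], [c]. The other two are
    joined through [z] off [z'], so [z'] does not separate them. *)
Lemma median_uniq a b c z z' : median z a b c -> median z' a b c -> z = z'.
Proof.
case/and3P=> ab bc ac /and3P[ab' bc' ac']; apply/eqP/negPn/negP => zz'.
have join u v : sep z u z' -> sep z v z' -> ~~ sep z' u v.
  move=> su sv; rewrite /sep negb_or negbK; apply/andP; split.
    by apply: contraTneq su => ->; rewrite sepxx eq_sym.
  apply: (connect_trans (y := z)); first by apply: sep_connect; rewrite 1?eq_sym.
  by rewrite avoid_connect_sym; apply: sep_connect; rewrite 1?eq_sym.
have two u v : sep z u v -> sep z u z' || sep z v z'.
  apply: contraLR; rewrite negb_or => /andP[su sv].
  by apply: nsep_trans su _; rewrite sep_sym.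
have [sa|na] := boolP (sep z a z').
  have := two _ _ bc => /orP[sb|sc].
    by move: (join _ _ sa sb); rewrite ab'.
  by move: (join _ _ sa sc); rewrite ac'.
have sb : sep z b z' by move: (two _ _ ab); rewrite (negPf na).
have sc : sep z c z' by move: (two _ _ ac); rewrite (negPf na).
by move: (join _ _ sb sc); rewrite bc'.
Qed.

(** The form in which acyclicity enters. *)
Hypothesis neighbors_apart :
  forall g a b, f g a -> f g b -> connect (avoid g) a b -> a = b.

(* Move [g] from [x] towards [R] for as long as [R] lies beyond a single
   neighbour of [g]. *)
Lemma gate x (R : {set I}) r0 : r0 \in R ->
  exists g, (forall r, r \in R -> sep g x r) /\
    exists r1 r2, [/\ r1 \in R, r2 \in R & sep g r1 r2].
Proof.
move=> r0R; pose C g := [set y | ~~ sep g x y].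
pose P g := [forall r in R, sep g x r].
have Px : P x by apply/forall_inP => r _; rewrite /sep eqxx.
(* The farthest position of [g] is the one with the largest side [C g] around [x]. *)
case: (arg_maxnP (fun g => #|C g|) Px) => g /forall_inP Pg maxg.
exists g; split=> //.
case: (boolP [exists r1 in R, exists r2 in R, sep g r1 r2]) => [|nex].
  by case/exists_inP=> r1 r1R /exists_inP[r2 r2R s]; exists r1, r2.
have one r1 r2 : r1 \in R -> r2 \in R -> ~~ sep g r1 r2.
  move=> r1R r2R; apply: contra nex => s; apply/exists_inP; exists r1 => //.
  by apply/exists_inP; exists r2.
have r0g : r0 != g by have := one _ _ r0R r0R; rewrite sepxx.
(* All of [R] lies on one side of [g]; moving to the neighbour [g'] on that side will contradict
   maximality. *)
have [g' r0g' g'g] := exit_neighbor (fun _ _ h => h) (fconn r0 g) r0g.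
have g'ng : g' != g by move: r0g'; rewrite sep_sym /sep negb_or => /andP[].
have far r : r \in R -> sep g' g r.
  move=> rR; rewrite /sep eq_sym (negPf g'ng) /=; apply/negP => gr.
  have rg : r != g by have := one _ _ rR rR; rewrite sepxx.
  rewrite avoid_connect_sym in gr.
  have sub : subrel (avoid g') f by move=> a b /andP[].
  (* A path from [r] to [g] off [g'] enters [g] by a second neighbour [h] on the same side of [g] as
     [g']. *)
  have [h rh /and3P[hg hg' _]] := exit_neighbor sub gr rg.
  have : ~~ sep g g' h.
    apply: nsep_trans rh; apply: nsep_trans (one _ _ r0R rR).
    by rewrite sep_sym.
  rewrite /sep negb_or negbK => /andP[_ c].
  by rewrite (neighbors_apart _ _ c) 1?fsym ?eqxx // in hg'.
have sxg' : sep g x g'.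
  apply: contraLR (Pg _ r0R) => n; apply: nsep_trans n _; by rewrite sep_sym.
have Pg' : P g' by apply/forall_inP => r rR; apply: sep_trans (Pg _ rR) (far _ rR).
have xg' : x != g' by apply: contraTneq sxg' => ->; rewrite sepxx.
have gC : g \in C g'.
  by rewrite inE /sep negb_or negbK xg' sep_connect.
have sCC : C g \proper C g'.
  apply/properP; split; last first.
    by exists g => //; rewrite inE negbK sep_sym /sep eqxx.
  apply/subsetP => y; rewrite inE => nxy.
  have syg' : sep g y g' by apply: contraLR sxg' => n; apply: nsep_trans nxy n.
  rewrite inE in gC; rewrite inE; apply: nsep_trans gC _.
  rewrite sep_sym /sep negb_or negbK sep_connect // andbT.
  by apply: contraTneq syg' => ->; rewrite sepxx.
have le := maxg g' Pg'.
by have := leq_ltn_trans le (proper_card sCC); rewrite ltnn.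
Qed.

(** Seen from [g], let [z] be the gate of the part of [R] on the side of [r1]. That part leaves [z]
    in two directions, and [r2], lying across [g], supplies the third. *)
Lemma branch_median g (R : {set I}) r1 r2 :
  r1 \in R -> r2 \in R -> r1 != g -> sep g r1 r2 ->
  exists2 z, exists a b c, [/\ a \in R, b \in R, c \in R & median z a b c] &
    forall r, r \in R -> ~~ sep g r1 r -> sep z g r.
Proof.
move=> r1R r2R r1g s12; pose A := [set r in R | ~~ sep g r1 r].
have r1A : r1 \in A by rewrite inE r1R sepxx.
have [z [gz [a1 [a2 []]]]] := gate g r1A.
move=> a1A a2A s; exists z; last by move=> r rR nr; apply: gz; rewrite inE rR.
have sga1 := gz _ a1A; have sga2 := gz _ a2A.
move: a1A a2A; rewrite !inE => /andP[a1R n1] /andP[a2R n2].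
have n12 : ~~ sep g a1 a2 by apply: nsep_trans n2; rewrite sep_sym.
have zg : z != g by apply: contraNneq n12 => <-.
(* Otherwise [g] cuts [z] off from [a1] and [a2], which are then joined through [g] off [z]. *)
have s2z : sep g r2 z.
  apply: contraT => n2z.
  have s1z : sep g r1 z.
    by apply: contraLR s12 => n1z; apply: nsep_trans n1z _; rewrite sep_sym.
  have sz a : ~~ sep g r1 a -> sep g a z.
    by move=> na; apply: contraLR s1z; apply: nsep_trans na.
  move: s; rewrite /sep; have [a1z|_ /=] := eqVneq a1 z.
    by have := sz _ n1; rewrite a1z sepxx (negPf zg).
  case/negP; apply: (connect_trans (sep_connect zg (sz _ n1))).
  by rewrite avoid_connect_sym; apply: sep_connect => //; apply: sz.
have sr a : sep z g a -> sep z a r2.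
  apply: contraLR; rewrite [sep z a r2]sep_sym /sep !negb_or !negbK.
  case/andP=> r2z cra; rewrite [g == z]eq_sym zg /=; apply: connect_trans cra.
  by rewrite avoid_connect_sym; apply: sep_connect.
exists a1, a2, r2; split=> //; rewrite /median s !sr //.
Qed.

(** Let [g] be the gate of [R] seen from [x]. If three nodes of [R] are pairwise separated by [g],
    then [g] is their median; otherwise [R] occupies two sides of [g], and each side has its own
    median. *)
Lemma two_medians x (R : {set I}) r0 : r0 \in R ->
  exists z : bool -> I,
    (forall i, exists a b c, [/\ a \in R, b \in R, c \in R & median (z i) a b c]) /\
    (forall r, r \in R -> exists i, sep (z i) x r).
Proof.
move=> r0R; have [g [gx [r1 [r2 [r1R r2R s12]]]]] := gate x r0R.
case: (boolP [exists r3 in R, sep g r1 r3 && sep g r2 r3]) => [|nex].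
  case/exists_inP=> r3 r3R /andP[s13 s23]; exists (fun=> g); split.
    by move=> _; exists r1, r2, r3; rewrite /median s12 s13 s23.
  by move=> r /gx; exists true.
have two r : r \in R -> ~~ sep g r1 r \/ ~~ sep g r2 r.
  move=> rR; apply/orP; rewrite -negb_and; apply: contra nex => s.
  by apply/exists_inP; exists r.
have s21 : sep g r2 r1 by rewrite sep_sym.
have r1g : r1 != g by case: (two _ r1R); rewrite ?s21 // sepxx.
have r2g : r2 != g by case: (two _ r2R); rewrite ?s12 // sepxx.
have [z1 M1 S1] := branch_median r1R r2R r1g s12.
have [z2 M2 S2] := branch_median r2R r1R r2g s21.
exists (fun i => if i then z1 else z2); split; first by case.
move=> r rR; case: (two _ rR) => n; [exists true|exists false].
  exact: sep_trans (gx _ rR) (S1 _ rR n).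
exact: sep_trans (gx _ rR) (S2 _ rR n).
Qed.

End Separation.

(** A simple path from [a] to [b] off [g] would close up to a cycle through [g]. *)
Lemma tree_neighbors_apart (I : finType) (f : rel I) g a b : is_tree f ->
  f g a -> f g b -> connect (avoid f g) a b -> a = b.
Proof.
case=> fsym firr _ _ acyc ga gb /connectP[p pth lst].
have [//|ab] := eqVneq a b; move: lst.
case/shortenP: pth => q qth uq _ bq.
have ng : g \notin a :: q.
  have : all (fun y => y != g) (a :: q).
    have ag : a != g by apply: contraTneq ga => ->; rewrite firr.
    rewrite /= ag /=; elim: (q) a qth {uq bq ab ga ag} => //= y s IHs a.
    by case/andP=> /and3P[_ _ ->] /IHs ->.
  by move/allP => al; apply/negP => /al; rewrite eqxx.
have fq : path f a q by apply: sub_path qth => u v /and3P[].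
have := acyc g (a :: q); rewrite /= ga fq -bq fsym gb => /(_ isT).
rewrite /= in ng uq; rewrite ng uq => /(_ isT).
by case: (q) bq ab => [/= ->|? ? _ _ /(_ isT)]; rewrite ?eqxx.
Qed.

(** * Storing slots as a subsample and a bitstring *)

Lemma bit_encoding (A : finType) K : #|A| <= 2 ^ K ->
  exists2 enc : A -> seq bool, injective enc & forall a, size (enc a) <= K.
Proof.
move=> cA; have cK : #|A| <= #|{: K.-tuple bool}| by rewrite card_tuple card_bool.
exists (fun a => val (enum_val (widen_ord cK (enum_rank a)))).
  move=> a b /val_inj /enum_val_inj /(congr1 val) /= /val_inj; exact: enum_rank_inj.
by move=> a; rewrite size_tuple.
Qed.

(* The sample keeps the vertices occurring in the slots; the bits record, slot
   by slot, the position of its vertex in the enumeration of the kept ones. *)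
Lemma slots_scheme (V J : finType) (E : {set V} -> Prop)
    (rec : {ffun J -> option V} -> {set V}) K :
  #|J|.+1 ^ #|J| <= 2 ^ K ->
  (forall g, E (rec g)) ->
  (forall X, is_sample E X -> exists2 g : {ffun J -> option V},
     forall j v, g j = Some v -> v \in X.1 :|: X.2 & realizes (rec g) X) ->
  has_proper_scheme_of_size_le E (#|J| + K).
Proof.
move=> cJ Erec compl.
have [enc enc_inj enc_size] : exists2 enc : {ffun J -> 'I_#|J|.+1} -> seq bool,
    injective enc & forall a, size (enc a) <= K.
  by apply: bit_encoding; rewrite card_ffun card_ord.
pose good X (g : {ffun J -> option V}) :=
  [forall j, if g j is Some v then v \in X.1 :|: X.2 else true] && realizes (rec g) X.
pose slots X := odflt [ffun=> None] [pick g | good X g].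
pose verts (g : {ffun J -> option V}) := [set v | [exists j, g j == Some v]].
pose keep X := (X.1 :&: verts (slots X), X.2 :&: verts (slots X)).
(* The position [#|J|] encodes an empty slot: at most [#|J|] vertices are kept, so [nth] returns its
   default [None] there. *)
pose pos (Y : sample_t V) (g : {ffun J -> option V}) : {ffun J -> 'I_#|J|.+1} :=
  [ffun j => inord (if g j is Some v then index v (enum (Y.1 :|: Y.2)) else #|J|)].
pose dec (Y : sample_t V) (h : {ffun J -> 'I_#|J|.+1}) : {ffun J -> option V} :=
  [ffun j => nth None (map Some (enum (Y.1 :|: Y.2))) (h j)].
pose kappa X := (keep X, enc (pos (keep X) (slots X))).
pose rho (Yb : sample_t V * seq bool) :=
  rec (dec Yb.1 (odflt [ffun=> ord0] [pick h | enc h == Yb.2])).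
exists kappa, rho, #|J|, K; split=> //; split; last by move=> Y b _; apply: Erec.
move=> X sX; have : good X (slots X).
  rewrite /slots; case: pickP => //= none; case: (compl X sX) => g gX gr.
  case/negP: (negbT (none g)); rewrite /good gr andbT; apply/forallP => j.
  by case gj: (g j) => [v|//]; apply: (gX j).
case/andP=> /forallP inX real.
have vc : #|verts (slots X)| <= #|J|.
  have sub : [set Some v | v in verts (slots X)] \subset [set slots X j | j in J].
    apply/subsetP => o /imsetP[v]; rewrite inE => /existsP[j /eqP gj] ->.
    by rewrite -gj imset_f.
  rewrite -(card_imset (verts (slots X)) (@Some_inj _)).
  by apply: leq_trans (subset_leq_card sub) (leq_imset_card _ _).
have kU : (keep X).1 :|: (keep X).2 = verts (slots X).
  rewrite /= -setIUl; apply/setIidPr/subsetP => v; rewrite inE => /existsP[j /eqP gj].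
  by have := inX j; rewrite gj.
have dK : dec (keep X) (pos (keep X) (slots X)) = slots X.
  apply/ffunP => j; rewrite !ffunE; rewrite kU.
  case gj: (slots X j) => [v|].
    have vin : v \in enum (verts (slots X)).
      by rewrite mem_enum inE; apply/existsP; exists j; rewrite gj.
    have il : index v (enum (verts (slots X))) < #|J|.
      by apply: leq_trans vc; rewrite cardE index_mem.
    rewrite inordK; last by rewrite ltnW.
    by rewrite (nth_map v) ?index_mem // nth_index.
  by rewrite inordK // nth_default // size_map -cardE.
split.
- by rewrite /subsample /= !subsetIl.
- rewrite /rho /=; case: pickP => [h /eqP /enc_inj ->|none]; first by rewrite /= dK.
  by have := none (pos (keep X) (slots X)); rewrite eqxx.
- by rewrite /sample_size kU.
- exact: enc_size.
Qed.

(** * Minimisers of a weight *)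

Section LeastElement.

Variables (A : finType) (P : pred A) (F : A -> nat).

Definition least : option A :=
  [pick a | P a && [forall b, P b ==> (F a <= F b)]].

Variant least_spec : option A -> Prop :=
  | Least a of P a & (forall b, P b -> F a <= F b) : least_spec (Some a)
  | NoLeast of (forall a, ~~ P a) : least_spec None.

Lemma leastP : least_spec least.
Proof.
rewrite /least; case: pickP => [a /andP[Pa /forallP le]|none]; constructor => //.
  by move=> b Pb; have := le b; rewrite Pb.
move=> a; apply/negP => Pa; case: (arg_minnP F Pa) => b Pb minb.
case/negP: (negbT (none b)); rewrite Pb; apply/forallP => c.
by apply/implyP/minb.
Qed.

End LeastElement.

(** * Distances, balls and separating bags *)

Section Distance.

Variables (T : finType) (e : rel T).

Definition walk (u v : T) (k : nat) : bool :=
  [exists p : k.-tuple T, path e u p && (last u p == v)].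

(* Equal to [#|T|] when [v] cannot be reached from [u]. *)
Definition dist (u v : T) : nat := find (walk u v) (iota 0 #|T|).

Lemma walkP u v k :
  reflect (exists p, [/\ path e u p, last u p = v & size p = k]) (walk u v k).
Proof.
apply: (iffP existsP) => [[p /andP[pth /eqP lst]]|[p [pth lst sz]]].
  by exists p; rewrite size_tuple.
by exists (tcast sz (in_tuple p)); rewrite val_tcast /= pth lst eqxx.
Qed.

Lemma dist_leN u v : dist u v <= #|T|.
Proof. by rewrite (leq_trans (find_size _ _)) ?size_iota. Qed.

Lemma dist_le_size u p : path e u p -> dist u (last u p) <= size p.
Proof.
move=> pth; have [lt|] := ltnP (size p) #|T|; last exact: leq_trans (dist_leN _ _).
rewrite leqNgt; apply/negP => /(before_find 0); rewrite nth_iota // add0n.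
by move/negbT/negP; apply; apply/walkP; exists p.
Qed.

Lemma shortest_walk u v : dist u v < #|T| ->
  exists p, [/\ path e u p, last u p = v & size p = dist u v].
Proof.
move=> lt; apply/walkP; have := @nth_find _ 0 (walk u v) (iota 0 #|T|).
by rewrite has_find size_iota nth_iota //; apply.
Qed.

Lemma dist_triangle w u v : dist u v <= dist u w + dist w v.
Proof.
have [uw|ge] := ltnP (dist u w) #|T|; last first.
  by apply: leq_trans (dist_leN u v) (leq_trans ge (leq_addr _ _)).
have [wv|ge] := ltnP (dist w v) #|T|; last first.
  by apply: leq_trans (dist_leN u v) (leq_trans ge (leq_addl _ _)).
have [p [pp lp <-]] := shortest_walk uw; have [q [pq lq <-]] := shortest_walk wv.
have := @dist_le_size u (p ++ q).
by rewrite cat_path last_cat lp pp pq lq size_cat; apply.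
Qed.

(** For radii below [#|T|] the cap on [dist] keeps unreachable vertices outside. *)
Lemma ball_dist c r : r < #|T| -> ball e c (Posz r) = [set v | dist c v <= r].
Proof.
move=> rT; apply/setP => v; rewrite !inE; apply/existsP/idP.
  case=> k /andP[kr /walkP[p [pth <- sz]]].
  by apply: leq_trans (dist_le_size pth) _; rewrite sz.
move=> dr; have dT := leq_ltn_trans dr rT.
have dT1 : dist c v < #|T|.+1 by apply: leqW.
by exists (Ordinal dT1); rewrite lez_nat dr; apply/walkP/shortest_walk.
Qed.

(** A walk shortens to a simple path, which has fewer than [#|T|] edges. *)
Lemma ball_large_radius c r : #|T| <= r -> ball e c (Posz r) = ball e c (Posz #|T|.-1).
Proof.
have T0 : 0 < #|T| by apply/card_gt0P; exists c.
move=> Tr; rewrite [RHS]ball_dist ?prednK //; apply/setP => v; rewrite !inE; apply/existsP/idP.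
  case=> k /andP[_ /walkP[p [pth <- _]]]; case/shortenP: pth => q pq uq _.
  apply: leq_trans (dist_le_size pq) _; rewrite -ltnS prednK //.
  by have := max_card (mem (c :: q)); rewrite (card_uniqP uq).
rewrite -ltnS prednK // => dT; exists (Ordinal (leqW dT)); rewrite lez_nat /=.
by rewrite (leq_trans (ltnW dT)) //; apply/walkP/shortest_walk.
Qed.

Lemma ball_negative c k : ball e c (Negz k) = set0.
Proof. by apply/setP => v; rewrite !inE; apply/existsP => -[]. Qed.

(** This makes the pairs of centre and radius a finite type, over which the decoder can minimise. *)
Lemma ball_nonempty_radius c (r : int) v : v \in ball e c r ->
  exists s : 'I_#|T|, ball e c r = [set v | dist c v <= s].
Proof.
have T0 : 0 < #|T| by apply/card_gt0P; exists c.
case: r => k; last by rewrite ball_negative inE.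
move=> _; have [lt|ge] := ltnP k #|T|.
  by exists (Ordinal lt); rewrite ball_dist.
have lt : #|T|.-1 < #|T| by rewrite prednK.
by exists (Ordinal lt); rewrite ball_large_radius // ball_dist.
Qed.

(** The nodes whose bags contain a fixed vertex outside [W z] are connected off [z], and consecutive
    vertices of a path share a bag. So a path missing [W z] would join [x] to [y] off [z]. *)
Lemma bag_separates (I : finType) (f : rel I) (W : I -> {set T}) z c v x y p :
  tree_decomposition e f W -> sep f z x y -> c \in W x -> v \in W y ->
  path e c p -> last c p = v -> exists2 w, w \in c :: p & w \in W z.
Proof.
case=> _ _ edge sub sxy cx vy pth lst.
case: (boolP [exists w in c :: p, w \in W z]) => [/exists_inP|no]; first by [].
have {}no w : w \in c :: p -> w \notin W z.
  by move=> wp; apply: contra no => wz; apply/exists_inP; exists w.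
have inner w a b : w \notin W z -> w \in W a -> w \in W b -> connect (avoid f z) a b.
  move=> wz wa wb; apply: connect_sub (sub _ _ _ wa wb) => a' b' /and3P[fab wa' wb'].
  by apply: connect1; rewrite /avoid fab /=; apply/andP; split;
     [apply: contraNneq wz => <-|apply: contraNneq wz => <-].
move: sxy; rewrite /sep; have [xz|_ /=] := eqVneq x z.
  by case/negP: (no c (mem_head _ _)); rewrite -xz.
case/negP; elim: p c x pth lst cx no => [|c1 p IHp] c x /=.
  by move=> _ cv cx no; apply: (inner c); rewrite ?no ?mem_head // cv.
case/andP=> cc1 pth lst cx no; have [x1 /andP[cx1 c1x1]] := edge _ _ cc1.
apply: (connect_trans (inner c _ _ (no c (mem_head _ _)) cx cx1)).
by apply: (IHp c1) => // w wp; apply: no; rewrite inE wp orbT.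
Qed.

Lemma dist_through_bag (I : finType) (f : rel I) (W : I -> {set T}) z c v x y :
  tree_decomposition e f W -> sep f z x y -> c \in W x -> v \in W y ->
  dist c v < #|T| -> exists2 w, w \in W z & dist c w + dist w v <= dist c v.
Proof.
move=> td s cx vy lt; have [p [pth lst sz]] := shortest_walk lt.
have [w wp wz] := bag_separates td s cx vy pth lst; exists w => //; rewrite -sz.
case/splitPl: wp pth lst => p1 p2 lw; rewrite cat_path last_cat lw size_cat.
by case/andP=> pp1 pp2 <-; rewrite -{1}lw leq_add // dist_le_size.
Qed.

(** * Balls controlled by distances through portals *)

Section Profile.

Variables (K : finType) (w : K -> T).

(** By the triangle inequality a vertex of [lo] is forced into the ball. A vertex of [hi] is only
    denied the detour through [w k]; [separated] is what turns this into exclusion. *)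
Definition fits (lo hi : K -> option T) (p : T * 'I_#|T|) : bool :=
  [forall k, (if lo k is Some v then dist p.1 (w k) + dist (w k) v <= p.2 else true)
          && (if hi k is Some v then p.2 < dist p.1 (w k) + dist (w k) v else true)].

Definition separated (X : sample_t T) (c : T) : Prop :=
  forall v, v \in X.1 :|: X.2 -> dist c v < #|T| ->
    exists k, dist c (w k) + dist (w k) v <= dist c v.

(** Extreme vertices speak for the others: each [v] in [X.1] is reached from [c] through some [w k]
    and is no farther from it than [lo k]. A [v] in [X.2] inside the new ball would be reached
    through some [w k], to which [hi k] is at least as near. *)
Lemma profile X c (r : 'I_#|T|) :
  realizes [set v | dist c v <= r] X -> separated X c ->
  exists lo hi : K -> option T,
    [/\ forall k v, lo k = Some v \/ hi k = Some v -> v \in X.1 :|: X.2,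
        fits lo hi (c, r) &
        forall p, fits lo hi p -> separated X p.1 ->
          realizes [set v | dist p.1 v <= p.2] X].
Proof.
case/andP=> /subsetP Xp /pred0P Xm sc.
pose covers k v := (v \in X.1) && (dist c (w k) + dist (w k) v <= r).
(* Subtracting from the upper bound [#|T|] on distances makes [least] choose a farthest vertex. *)
pose lo k := least (covers k) (fun v => #|T| - dist (w k) v).
pose hi k := least (mem X.2) (dist (w k)).
exists lo, hi; split.
- move=> k v [lok|hik]; rewrite inE.
    by move: lok; rewrite /lo; case: leastP => // a /andP[aX _] _ [<-]; rewrite aX.
  by move: hik; rewrite /hi; case: leastP => // a /= aX _ [<-]; rewrite aX orbT.
- apply/forallP => k; rewrite /lo /hi /=; apply/andP; split.
    by case: leastP => // a /andP[].
  case: leastP => // a /= aX _; apply: leq_trans (dist_triangle (w k) c a).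
  by have := Xm a; rewrite /= inE aX andbT ltnNge => ->.
case=> c' r' /forallP /= fit sc'; apply/andP; split.
  apply/subsetP => v vX; have := Xp v vX; rewrite !inE => vr.
  have [||k kr] := sc v; first by rewrite inE vX.
    exact: leq_ltn_trans vr _.
  have ck : covers k v by rewrite /covers vX (leq_trans kr).
  have := fit k; rewrite /lo; case: leastP => [a _ /(_ v ck) le|/(_ v)]; last by rewrite ck.
  case/andP=> fa _; apply: leq_trans (dist_triangle (w k) c' v) (leq_trans _ fa).
  rewrite leq_add2l; move: le; rewrite leq_subLR -leq_subLR => le.
  by rewrite -(subKn (dist_leN (w k) v)) -(subKn (dist_leN (w k) a)) leq_sub2l.
apply/pred0P => v; rewrite /= inE; apply/negP => /andP[vr vX].
have [||k kr] := sc' v; first by rewrite inE vX orbT.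
  exact: leq_ltn_trans vr _.
have := fit k; rewrite /hi; case: leastP => [a _ /(_ v vX) le|/(_ v)]; last by rewrite /= vX.
case/andP=> _; rewrite ltnNge => /negP[]; apply: leq_trans vr.
by apply: leq_trans kr; rewrite leq_add2l.
Qed.

End Profile.

End Distance.

(** * Components left by two nodes, and their order *)

Section Classes.

Variables (I : finType) (f : rel I) (z : bool -> I).
Hypothesis fsym : symmetric f.

Definition linked (x y : I) : bool := [forall i, ~~ sep f (z i) x y].

(** The rank of a canonical member of the class. A node [z i] is linked to nothing, not even itself,
    and represents itself. *)
Definition key (x : I) : nat := enum_rank (odflt x [pick y | linked x y]).

Lemma linked_sym x y : linked x y = linked y x.
Proof. by apply: eq_forallb => i; rewrite sep_sym. Qed.

Lemma linked_trans x y r : linked x y -> linked y r -> linked x r.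
Proof.
move=> /forallP xy /forallP yr; apply/forallP => i; exact: nsep_trans (xy i) (yr i).
Qed.

Lemma linked_key x y : linked x y -> key x = key y.
Proof.
move=> xy; rewrite /key; have -> : [pick a | linked x a] = [pick a | linked y a].
  apply: eq_pick => a; apply/idP/idP; last exact: linked_trans.
  by apply: linked_trans; rewrite linked_sym.
by case: pickP => //= /(_ x); rewrite linked_sym xy.
Qed.

Lemma key_linked x y r : key x = key y -> linked x r -> linked y r.
Proof.
move=> kxy xr; move: kxy => /val_inj /enum_rank_inj.
case: pickP => /= [m xm|/(_ r)]; last by rewrite xr.
case: pickP => /= [m' ym' mm'|none mx].
  by apply: linked_trans ym' _; rewrite -mm'; apply: linked_trans xr; rewrite linked_sym.
by apply: linked_trans xr; rewrite linked_sym -mx.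
Qed.

(* Freeness of a class depends on all of [R]; but the last class before the
   first free one, among the classes met by [P], contains an element of [R], and
   naming that element is enough to find the free class again. *)
Lemma first_free_class (A B : finType) (P : pred A) (nA : A -> I)
    (R : {set B}) (nB : B -> I) a0 :
  let free a := forall b, b \in R -> ~~ linked (nA a) (nB b) in
  P a0 -> free a0 ->
  exists o : option B,
    let Q a := P a && (if o is Some b then key (nB b) < key (nA a) else true) in
    [/\ forall b, o = Some b -> b \in R, exists a, Q a &
        forall a, Q a -> (forall a', Q a' -> key (nA a) <= key (nA a')) -> free a].
Proof.
move=> free Pa0 fa0.
pose freeb a := [forall b in R, ~~ linked (nA a) (nB b)].
have freeP a : reflect (free a) (freeb a) by apply: (iffP forall_inP).
have := leastP [pred a | P a && freeb a] (fun a => key (nA a)).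
case: {-}_ / => [a /andP[Pa /freeP fa] mina|/(_ a0)]; last first.
  by rewrite /= Pa0 => /freeP.
pose before b := (b \in R) && [exists a', [&& P a', key (nA a') == key (nB b)
  & key (nB b) < key (nA a)]].
have unfree a' : P a' -> key (nA a') < key (nA a) ->
    exists2 b, before b & key (nA a') = key (nB b).
  move=> Pa' lt; case: (boolP (freeb a')) => [fa'|].
    by have := mina a'; rewrite /= Pa' fa' => /(_ isT); rewrite leqNgt lt.
  rewrite negb_forall_in => /exists_inP[b bR]; rewrite negbK => /linked_key kab.
  exists b => //; rewrite /before bR /=; apply/existsP; exists a'.
  by rewrite Pa' kab eqxx -kab.
have same a' : key (nA a') = key (nA a) -> free a'.
  by move=> ka b bR; apply: contra (fa b bR); apply: key_linked.
have key_max x : key x <= #|I| by exact: ltnW (ltn_ord _).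
(* Picks the last preceding class; if there is none, [None] is sent. *)
have := leastP before (fun b => #|I| - key (nB b)).
case: {-}_ / => [b bb maxb|nb].
  have [bR /existsP[_ /and3P[_ _ lt]]] := andP bb.
  exists (Some b); split; first by move=> _ [<-].
    by exists a; rewrite Pa.
  move=> a' /andP[Pa' lt'] /(_ a); rewrite Pa lt => /(_ isT).
  (* A class met by [P] strictly between those of [b] and [a] is not free, so it contains some [b']
     in [R], against the choice of [b]. *)
  rewrite leq_eqVlt => /orP[/eqP/same//|lta].
  have [b' bb' kb'] := unfree _ Pa' lta; have := maxb _ bb'.
  by rewrite leq_sub2lE // leqNgt -kb' lt'.
exists None; split=> //; first by exists a; rewrite Pa.
move=> a' /andP[Pa' _] /(_ a); rewrite Pa => /(_ isT).
rewrite leq_eqVlt => /orP[/eqP/same//|lta].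
by have [b' bb'] := unfree _ Pa' lta; rewrite (negPf (nb b')) in bb'.
Qed.

End Classes.

(** * The decoder and its correctness *)

Section Reconstruction.

Variables (T : finType) (e : rel T) (t : nat) (I : finType) (f : rel I)
  (W : I -> {set T}) (node : T -> I) (c0 : T).
Hypotheses (td : tree_decomposition e f W) (Wt : forall x, #|W x| <= t.+1)
  (nodeP : forall v, v \in W (node v)).

(* Slots: three vertices for each of the two medians, the vertex naming the
   preceding class, and for each of the [2(t+1)] bag positions a vertex bounding
   the radius from below ([true]) and one bounding it from above ([false]). *)
Let slot : finType := ((bool * 'I_3) + option (bool * 'I_t.+1 * bool))%type.

Definition tripod (g : {ffun slot -> option T}) (i : bool) : I :=
  let a (j : 'I_3) := node (odflt c0 (g (inl (i, j)))) in
  odflt (node c0) [pick x | median f x (a (inord 0)) (a (inord 1)) (a (inord 2))].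

Definition bag_vertex (z : bool -> I) (k : bool * 'I_t.+1) : T :=
  nth c0 (enum (W (z k.1))) k.2.

Definition candidate (g : {ffun slot -> option T}) (p : T * 'I_#|T|) : bool :=
  let z := tripod g in
  fits e (bag_vertex z) (fun k => g (inr (Some (k, true))))
    (fun k => g (inr (Some (k, false)))) p &&
  (if g (inr None) is Some u then key f z (node u) < key f z (node p.1) else true).

(** A sample with nonempty [X.1] fills all six tripod slots, so an empty one can announce the empty
    ball, of radius -1. *)
Definition reconstruct (g : {ffun slot -> option T}) : {set T} :=
  if g (inl (true, ord0)) is None then ball e c0 (Negz 0) else
  if least (candidate g) (fun p => key f (tripod g) (node p.1)) is Some p
  then ball e p.1 (Posz p.2) else ball e c0 (Negz 0).

Lemma reconstruct_ball g : is_ball e (reconstruct g).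
Proof.
rewrite /reconstruct; case: (g _) => [_|]; last by exists c0, (Negz 0).
by case: least => [p|]; [exists p.1, (Posz p.2)|exists c0, (Negz 0)].
Qed.

Lemma bags_separated (z : bool -> I) (X : sample_t T) c :
  (forall v, v \in X.1 :|: X.2 -> ~~ linked f z (node c) (node v)) ->
  separated e (bag_vertex z) X c.
Proof.
move=> free v vX lt; have := free v vX; rewrite negb_forall => /existsP[i].
rewrite negbK => s; have [w wW le] := dist_through_bag td s (nodeP c) (nodeP v) lt.
have we : w \in enum (W (z i)) by rewrite mem_enum.
have jt : index w (enum (W (z i))) < t.+1.
  by apply: leq_trans (Wt (z i)); rewrite cardE index_mem.
by exists (i, Ordinal jt); rewrite /bag_vertex /= nth_index.
Qed.

Lemma reconstruct_complete (X : sample_t T) : is_sample (is_ball e) X ->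
  exists2 g : {ffun slot -> option T},
    forall j v, g j = Some v -> v \in X.1 :|: X.2 & realizes (reconstruct g) X.
Proof.
case=> _ [c [r0 ->]] real.
have [X0|/set0Pn[v0 v0X]] := eqVneq X.1 set0.
  exists [ffun=> None]; first by move=> j v; rewrite ffunE.
  rewrite /reconstruct ffunE ball_negative /realizes X0 sub0set.
  by apply/pred0P => v; rewrite /= inE.
have [tree _ _ _] := td; have [fsym _ _ fconn _] := tree.
have [r rball] : exists s : 'I_#|T|, ball e c r0 = [set v | dist e c v <= s].
  by apply: (ball_nonempty_radius (v := v0)); case/andP: real => /subsetP/(_ v0 v0X).
rewrite {}rball in real; pose R := X.1 :|: X.2.
have v0R : node v0 \in node @: R by rewrite imset_f // inE v0X.
have apart g a b : f g a -> f g b -> connect (avoid f g) a b -> a = b.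
  exact: tree_neighbors_apart.
have [z [zmed zsep]] := two_medians fsym fconn apart (node c) v0R.
have freec v : v \in R -> ~~ linked f z (node c) (node v).
  move=> vR; have [i s] := zsep _ (imset_f node vR).
  by rewrite negb_forall; apply/existsP; exists i; rewrite negbK.
have [lo [hi [lohiX fitc prof]]] := profile real (bags_separated freec).
(* The pair [(c, r)] itself fits and is free, so a first free class exists. *)
have [o [oR [p1 Qp1] first]] :=
  first_free_class fsym (P := fits e (bag_vertex z) lo hi) (nA := fun p => node p.1)
    (nB := node) (a0 := (c, r)) fitc freec.
have [a [aR amed]] : exists a : bool -> 'I_3 -> T, (forall i j, a i j \in R) /\
    forall i, median f (z i) (node (a i (inord 0))) (node (a i (inord 1)))
      (node (a i (inord 2))).
  have pick3 i : exists b : 'I_3 -> T, (forall j, b j \in R) /\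
      median f (z i) (node (b (inord 0))) (node (b (inord 1))) (node (b (inord 2))).
    have [_ [_ [_ [/imsetP[b0 b0R ->] /imsetP[b1 b1R ->] /imsetP[b2 b2R ->] m]]]] := zmed i.
    exists (fun j : 'I_3 => nth b0 [:: b0; b1; b2] j); split; last by rewrite !inordK.
    by case=> -[|[|[|]]].
  have [[at_ [atR atm]] [af [afR afm]]] := (pick3 true, pick3 false).
  by exists (fun i => if i then at_ else af); split=> -[].
pose g : {ffun slot -> option T} := [ffun j => match j with
  | inl (i, j) => Some (a i j)
  | inr None => o
  | inr (Some (k, true)) => lo k
  | inr (Some (k, false)) => hi k
  end].
(* Uniqueness of medians lets the decoder recover exactly the nodes [z i]. *)
have zE i : tripod g i = z i.
  rewrite /tripod !ffunE /=; case: pickP => [x /= mx|/(_ (z i))]; last by rewrite amed.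
  exact: median_uniq mx (amed i).
have keyE x : key f (tripod g) x = key f z x.
  rewrite /key; congr (nat_of_ord (enum_rank (odflt _ _))); apply: eq_pick => y.
  by apply: eq_forallb => i; rewrite zE.
have candE p : candidate g p = fits e (bag_vertex z) lo hi p &&
    (if o is Some b then key f z (node b) < key f z (node p.1) else true).
  rewrite /candidate !ffunE; congr andb; last by case: (o) => // b; rewrite !keyE.
  by apply: eq_forallb => k; rewrite !ffunE /bag_vertex zE.
exists g.
  move=> j v; rewrite ffunE; case: j => [[i j] [<-]|[[k []]|]].
  - exact: aR.
  - by move=> h; apply: lohiX; left; apply: h.
  - by move=> h; apply: lohiX; right; apply: h.
  - exact: oR.
rewrite /reconstruct {1}/g ffunE; case: leastP => [p|/(_ p1)]; last by rewrite candE Qp1.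
rewrite candE => Qp minp; rewrite ball_dist //.
(* Having the least key, [p] lies in a free class, so the two bags separate its centre from the
   sample. *)
apply: prof; first by case/andP: Qp.
apply: bags_separated => v vR; apply: (first p Qp) => // p' Qp'.
by have := minp p'; rewrite candE !keyE; apply.
Qed.

Lemma ball_scheme K : (4 * t + 12) ^ (4 * t + 11) <= 2 ^ K ->
  has_proper_scheme_of_size_le (is_ball e) (4 * t + 11 + K).
Proof.
(* Six tripod slots, one naming a class, and [4(t+1)] radius bounds. *)
have cs : #|slot| = 4 * t + 11.
  rewrite card_sum card_option !card_prod card_bool !card_ord.
  lia.
move=> hK; rewrite -cs; apply: (slots_scheme (rec := reconstruct)).
- by rewrite cs -addnS.
- exact: reconstruct_ball.
- exact: reconstruct_complete.
Qed.

End Reconstruction.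

(** * The size estimate *)

Lemma scheme_of_empty (V : finType) (E : {set V} -> Prop) s :
  (forall A, ~ E A) -> has_proper_scheme_of_size_le E s.
Proof.
move=> noE; exists (fun X => (X, [::])), (fun=> set0), 0, 0; split=> //.
by split=> [X|Y b] [A /noE].
Qed.

(** Each of the [4t+11] slots costs one vertex and [trunc_log 2 t + 5] bits. *)
Definition scheme_size (t : nat) : nat :=
  (4 * t + 11) * (trunc_log 2 t + 6).

Lemma slot_code_bound t : 0 < t ->
  (4 * t + 12) ^ (4 * t + 11) <= 2 ^ ((4 * t + 11) * (trunc_log 2 t + 5)).
Proof.
move=> t0; rewrite [_ * (_ + 5)]mulnC expnM leq_exp2r; last by rewrite addnS.
have := trunc_log_ltn t (isT : 1 < 2); set l := trunc_log 2 t => tl.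
have -> : 2 ^ (l + 5) = 16 * 2 ^ l.+1 by rewrite -(expnD 2 4); congr expn; lia.
lia.
Qed.

Lemma ln_mono (x y : R) : (0 < x)%R -> (x <= y)%R -> (ln x <= ln y)%R.
Proof.
by move=> x0 [lt|->]; [left; apply: ln_increasing|right].
Qed.

Lemma trunc_log2_le_ln t : 0 < t -> Rle (INR (trunc_log 2 t) * ln 2)%R (ln (INR t + 1)).
Proof.
move=> t0; have /leP/le_INR := trunc_logP (isT : 1 < 2) t0.
set l := trunc_log 2 t; have -> : INR (2 ^ l) = (2 ^ l)%R.
  by elim: l => // n IHn; rewrite expnS mult_INR IHn.
have p0 : (0 < 2 ^ l)%R by apply: pow_lt; lra.
move=> le; rewrite -ln_pow; last by lra.
by apply: ln_mono; lra.
Qed.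

(** The constant is [105 = 15 * 7]: for [t >= 1], [4t+11 <= 15t], and since the binary logarithm of
    [t+1] is at least 1 and at least [trunc_log 2 t], seven times it bounds [trunc_log 2 t + 6]. *)
Lemma scheme_size_bound t : 0 < t ->
  Rle (INR (scheme_size t)) (Rmult (Rmult (105 / ln 2) (INR t)) (ln (INR t + 1))).
Proof.
move=> t0; have l2 := ln_lt_2; have lt := trunc_log2_le_ln t0.
have t1 : (1 <= INR t)%R by apply: (le_INR 1); apply/leP.
have ln2 : (ln 2 <= ln (INR t + 1))%R by apply: ln_mono; lra.
have INRM m n : INR (m * n) = (INR m * INR n)%R by exact: mult_INR.
have INRD m n : INR (m + n) = (INR m + INR n)%R by exact: plus_INR.
rewrite /scheme_size INRM (INRD (4 * t) 11) (INRD _ 6) INRM.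
set l := INR (trunc_log 2 t) in lt *; set L := ln (INR t + 1) in lt ln2 *.
have l0 : (0 <= l)%R by apply: pos_INR.
have -> : (105 / ln 2 * INR t * L = (15 * INR t) * (7 * (L / ln 2)))%R by field; lra.
have lL : (l + 6 <= 7 * (L / ln 2))%R.
  apply: (Rmult_le_reg_r (ln 2)); first by lra.
  have -> : (7 * (L / ln 2) * ln 2 = 7 * L)%R by field; lra.
  lra.
have [-> -> ->] : [/\ INR 6 = 6, INR 4 = 4 & INR 11 = 11]%R.
  by rewrite !INR_IZR_INZ.
apply: Rmult_le_compat; lra.
Qed.

Theorem theorem1p1 :
  exists C : R, Rlt 0 C /\
    forall (t : nat), (0 < t)%N ->
    forall (T : finType) (e : rel T), simple_graph e -> treewidth_le e t ->
    exists s : nat,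
      Rle (INR s) (Rmult (Rmult C (INR t)) (ln (INR t + 1))) /\
      has_proper_scheme_of_size_le (is_ball e) s.
Proof.
exists (105 / ln 2)%R; split.
  by have := ln_lt_2 => l2; apply: Rdiv_lt_0_compat; lra.
move=> t t0 T e _ [I [f [W [td Wt]]]].
exists (scheme_size t); split; first exact: scheme_size_bound.
have [c0 _|T0] := pickP T; last first.
  by apply: scheme_of_empty => A [c]; have := T0 c.
have cover v : exists x, v \in W x by case: td.
have := ball_scheme c0 td Wt (fun v => xchooseP (cover v)) (slot_code_bound t0).
by rewrite /scheme_size [_ + 6]addnS mulnS.
Qed.
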